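(* Let $e\in\mathbb{N}$ and let $a,b\in\mathbb{N}$ with $b-ea\ge0$. Set $$C_1:=C_{\mathbb{A},e}\big((q-1)\sigma_e+(q-2-b)F_e\big),\qquad C_2:=C_{\mathbb{A},e}\big((q-2-a)\sigma_e+(q-1)F_e\big).$$ Then $$C_{\mathbb{A},e}(a,b)^\perp=C_1+C_2 .$$
   Context: $q$ is a prime power, $\mathbb{F}_q=\{\alpha_1,\dots,\alpha_q\}$ is the field with $q$ elements, $\mathbb{N}=\{0,1,2,\dots\}$, and $0^0:=1$. Duals are taken with respect to the standard (Euclidean) bilinear form. For integers $a,b$, let $L_*(aS_e+bF_e)$ be the $\mathbb{F}_q$-span of the monomials $X_1^{d_1}X_2^{d_2}T_1^{c_1}T_2^{c_2}$ with nonnegative exponents satisfying $d_1+d_2=a$ and $c_1+c_2-ed_1=b-ea$; it is $\{0\}$ if there are no such monomials (for instance if $a<0$ or $b<0$). Let $C_e(a,b)\subset\mathbb{F}_q^{(q+1)^2}$ be the set of $(q+1)\times(q+1)$ matrices $\big(f(x_1,x_2,t_1,t_2)\big)$, $f\in L_*(aS_e+bF_e)$, with rows indexed by $(t_1,t_2)$ and columns by $(x_1,x_2)$, each running over $(0,1),(1,\alpha_1),\dots,(1,\alpha_q)$ in this order. The code $C_{\mathbb{A},e}(a,b)\subset\mathbb{F}_q^{q^2}$ is obtained from $C_e(a,b)$ by deleting the first row and the first column of every codeword. Moreover, for integers $a',b'$, $C_{\mathbb{A},e}(a'\sigma_e+b'F_e):=C_{\mathbb{A},e}(a',b'+ea')$.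 *)

(* Defs.v *)
From HB Require Import structures.
From mathcomp Require Import all_boot all_order all_algebra.
From mathcomp Require Import classical_sets.
From mathcomp Require Import mpoly.

Set Implicit Arguments.
Unset Strict Implicit.
Unset Printing Implicit Defensive.

Import GRing.Theory.

Local Open Scope classical_set_scope.
Local Open Scope ring_scope.

Definition lspan (F : fieldType) (V : lmodType F) (S : set V) : set V :=
  [set v | exists (n : nat) (k : 'I_n -> F) (w : 'I_n -> V),
     (forall i, S (w i)) /\ v = \sum_(i < n) k i *: w i].

Definition sumset (V : zmodType) (A B : set V) : set V :=
  [set x + y | x in A & y in B].

Definition X1 (F : fieldType) : {mpoly F[4]} := 'X_(@Ordinal 4 0 isT).
Definition X2 (F : fieldType) : {mpoly F[4]} := 'X_(@Ordinal 4 1 isT).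
Definition T1 (F : fieldType) : {mpoly F[4]} := 'X_(@Ordinal 4 2 isT).
Definition T2 (F : fieldType) : {mpoly F[4]} := 'X_(@Ordinal 4 3 isT).

Definition Lmonomials (F : fieldType) (e : nat) (a b : int) :
    set {mpoly F[4]} :=
  [set f | exists d1 d2 c1 c2 : nat,
     [/\ d1%:Z + d2%:Z = a,
         c1%:Z + c2%:Z - e%:Z * d1%:Z = b - e%:Z * a
       & f = X1 F ^+ d1 * X2 F ^+ d2 * T1 F ^+ c1 * T2 F ^+ c2]].

Definition Lstar (F : fieldType) (e : nat) (a b : int) : set {mpoly F[4]} :=
  lspan (@Lmonomials F e a b).

(* The q + 1 representatives (0,1), (1,alpha_1), ..., (1,alpha_q) of the points
   of P^1(F), in this order. *)
Definition P1pt (F : fieldType) (q : nat) (alpha : 'I_q -> F) (i : 'I_q.+1) :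
    F * F :=
  if unlift ord0 i is Some j then (1, alpha j) else (0, 1).

Definition eval4 (F : fieldType) (f : {mpoly F[4]}) (x t : F * F) : F :=
  f.@[tnth [tuple x.1; x.2; t.1; t.2]].

(* Rows are indexed by (t1,t2) and columns by (x1,x2). *)
Definition evalmx (F : fieldType) (q : nat) (alpha : 'I_q -> F)
    (f : {mpoly F[4]}) : 'M[F]_q.+1 :=
  \matrix_(i, j) eval4 f (P1pt alpha j) (P1pt alpha i).

Definition code (F : fieldType) (q : nat) (alpha : 'I_q -> F)
    (e : nat) (a b : int) : set 'M[F]_q.+1 :=
  [set evalmx alpha f | f in @Lstar F e a b].

Definition affcode (F : fieldType) (q : nat) (alpha : 'I_q -> F)
    (e : nat) (a b : int) : set 'M[F]_q :=
  [set row' ord0 (col' ord0 M) | M in code alpha e a b].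

(* The code of the class a sigma_e + b F_e. *)
Definition affcode_sigma (F : fieldType) (q : nat) (alpha : 'I_q -> F)
    (e : nat) (a b : int) : set 'M[F]_q :=
  affcode alpha e a (b + e%:Z * a).

(* F^(q^2) is identified with the q x q matrices, so that the standard bilinear
   form is the sum of the entrywise products. *)
Definition mxdot (F : fieldType) (q : nat) (A B : 'M[F]_q) : F :=
  \sum_(i < q) \sum_(j < q) A i j * B i j.

Definition dual (F : fieldType) (q : nat) (C : set 'M[F]_q) : set 'M[F]_q :=
  [set A | forall B, C B -> mxdot A B = 0].

(* Main.v *)
(** On the affine chart the monomial X1^d1 X2^d2 T1^c1 T2^c2 becomes x^d2 y^c2, so
   every affine code is spanned by the monomials x^i y^j with (i, j) in a
   down-closed region of N^2.  Two facts about F = F_q suffice.  First, the power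
   sum of exponent m over F vanishes for m < q - 1; this gives C1 + C2 <= dual,
   since a product of a monomial of the code with one of C1 or C2 always has
   x-degree or y-degree at most q - 2.  Second, the indicator of x = y is
   1 - sum_(i < q) x^i y^(q-1-i) = sum_(i < q) x^i g_i(y); expanding a word A
   with it in both variables shows that the coefficient of x^i y^j in A is the
   inner product of A with g_i(x) g_j(y).  If (q-1-i, q-1-j) lies in the region
   of the code, so do all exponents in g_i g_j, and the coefficient vanishes
   when A is in the dual; the other monomials x^i y^j are exactly those in C1 or C2. *)
Require Import Defs.
From HB Require Import structures.
From mathcomp Require Import all_boot all_order all_algebra.
From mathcomp Require Import finfield.
From mathcomp Require Import classical_sets.
From mathcomp Require Import mpoly ring zify.

Import GRing.Theory Num.Theory.

Local Open Scope ring_scope.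

Section Span.
Context {F : fieldType}.
Implicit Types U V : lmodType F.

Lemma sub_lspan {V} (S : set V) (v : V) : S v -> lspan S v.
Proof.
move=> Sv; exists 1%N, (fun=> 1), (fun=> v); split=> //.
by rewrite big_ord1 scale1r.
Qed.

Lemma lspan0 {V} (S : set V) : lspan S 0.
Proof.
exists 0%N, (fun=> 0), (fun=> 0); split; first by case.
by rewrite big_ord0.
Qed.

Lemma lspanZ {V} (S : set V) (a : F) (v : V) : lspan S v -> lspan S (a *: v).
Proof.
move=> [n [k [w [Sw ->]]]]; exists n, (fun i => a * k i), w; split=> //.
by rewrite scaler_sumr; apply: eq_bigr => i _; rewrite scalerA.
Qed.

Lemma lspanD {V} (S : set V) (u v : V) : lspan S u -> lspan S v -> lspan S (u + v).
Proof.
move=> [m [k [w [Sw ->]]]] [n [k' [w' [Sw' ->]]]].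
pose glue T (f : 'I_m -> T) (g : 'I_n -> T) i :=
  match split i with inl j => f j | inr j => g j end.
have glueL T f g i : glue T f g (lshift n i) = f i.
  by rewrite /glue (unsplitK (inl i : 'I_m + 'I_n)).
have glueR T f g i : glue T f g (rshift m i) = g i.
  by rewrite /glue (unsplitK (inr i : 'I_m + 'I_n)).
exists (m + n)%N, (glue _ k k'), (glue _ w w'); split.
  by move=> i; rewrite /glue; case: split.
by rewrite big_split_ord; congr (_ + _);
  apply: eq_bigr => i _; rewrite ?glueL ?glueR.
Qed.

Lemma lspan_sum {V} (S : set V) (I : finType) (P : pred I) (f : I -> V) :
  (forall i, P i -> lspan S (f i)) -> lspan S (\sum_(i | P i) f i).
Proof. by move=> Sf; apply: big_ind => //; [apply: lspan0 | apply: lspanD]. Qed.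

Lemma lspan_image {U V} (f : {linear U -> V}) (S : set U) :
  ([set f u | u in lspan S] = lspan [set f u | u in S])%classic.
Proof.
apply/seteqP; split=> [_ [_ [n [k [w [Sw ->]]]] <-]|v [n [k [w [Sw ->]]]]].
  exists n, k, (f \o w); split; first by move=> i; exists (w i).
  by rewrite linear_sum; apply: eq_bigr => i _; rewrite linearZ.
have [s Ss fs] := fin_all_exists2 Sw.
exists (\sum_(i < n) k i *: s i); first by exists n, k, s.
by rewrite linear_sum; apply: eq_bigr => i _; rewrite linearZ fs.
Qed.

End Span.

Section BilinearForm.
Context {F : fieldType} {q : nat}.
Implicit Types (A B : 'M[F]_q) (S : set 'M[F]_q).

Lemma mxdotC A B : mxdot A B = mxdot B A.
Proof. by apply: eq_bigr => i _; apply: eq_bigr => j _; rewrite mulrC. Qed.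

Fact mxdot_is_linear A : linear (mxdot A : 'M[F]_q -> F^o).
Proof.
move=> k B C; rewrite /mxdot scaler_sumr -big_split; apply: eq_bigr => i _ /=.
rewrite scaler_sumr -big_split; apply: eq_bigr => j _ /=.
by rewrite !mxE mulrDr mulrCA.
Qed.

HB.instance Definition _ A :=
  GRing.isLinear.Build F 'M[F]_q F^o *:%R (mxdot A) (mxdot_is_linear A).

Lemma dual_lspan S : dual (lspan S) = dual S.
Proof.
apply/seteqP; split=> A dA B; first by move/sub_lspan; apply: dA.
move=> [n [k [w [Sw ->]]]]; rewrite linear_sum big1 // => i _.
by rewrite linearZ /= dA ?scaler0.
Qed.

Lemma lspan_sub_dual {S S'} :
  (forall A B, S A -> S' B -> mxdot A B = 0) ->
  (lspan S' `<=` dual S)%classic.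
Proof.
move=> SS' _ [n [k [w [Sw ->]]]] A SA.
rewrite mxdotC linear_sum big1 // => i _.
by rewrite linearZ /= SS' ?scaler0.
Qed.

End BilinearForm.

Section FiniteField.
Context {F : finFieldType} {q : nat} (card_F : #|F| = q).

(** Translation by 1 permutes F, so the sum of all elements is unchanged when q copies of 1 are
    added to it. *)
Lemma natr_card : q%:R = 0 :> F.
Proof.
have: \sum_(x : F) (x + 1) = \sum_(x : F) x.
  by rewrite [RHS](reindex_inj (addIr 1)).
by rewrite big_split /= sumr_const card_F -[RHS]addr0 => /addrI.
Qed.

Lemma sum_expr_eq0 m : (m < q.-1)%N -> \sum_(x : F) x ^+ m = 0.
Proof.
case: m => [|m] lt_mq.
  by under eq_bigr do rewrite expr0; rewrite sumr_const card_F natr_card.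
(* This single inequality gives both z <> 0 and z^(m+1) <> 1. Such a z exists since X^(m+2) - X has
   at most m+2 < q roots. Scaling by z then permutes F and multiplies the power sum by z^(m+1),
   which forces it to vanish. *)
have [z zm] : exists z : F, z ^+ m.+2 != z.
  apply/existsP; apply: contraLR lt_mq; rewrite negb_exists => /forallP allz.
  have sz : size ('X^(m.+2) - 'X : {poly F}) = m.+3.
    by rewrite size_polyDl ?size_polyN ?size_polyX size_polyXn.
  have pn0 : ('X^(m.+2) - 'X : {poly F}) != 0 by rewrite -size_poly_eq0 sz.
  have := max_poly_roots pn0 _ (enum_uniq F); rewrite sz -cardE card_F => lt_q.
  have : (q < m.+3)%N.
    apply: lt_q; apply/allP => x _; have := allz x; rewrite negbK => /eqP xm.
    by rewrite rootE !hornerE xm subrr.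
  lia.
have z0 : z != 0 by apply: contraNneq zm => ->; rewrite expr0n.
have : z ^+ m.+1 * \sum_(x : F) x ^+ m.+1 = \sum_(x : F) x ^+ m.+1.
  rewrite [RHS](reindex_inj (mulfI z0)) mulr_sumr.
  by apply: eq_bigr => x _; rewrite exprMn.
move/eqP; rewrite -subr_eq0 -{2}[\sum_x _]mul1r -mulrBl mulf_eq0 subr_eq0.
case/orP=> /eqP // zm1; by rewrite exprS zm1 mulr1 eqxx in zm.
Qed.

(* Up to sign y^(q-1-i); the correction at i = 0 is needed because y^(q-1) pairs
   nontrivially with x^(q-1) as well as with x^0. *)
Definition dualmon (i : nat) (y : F) : F := (i == 0%N)%:R - y ^+ (q.-1 - i).

Lemma sum_dualmon (x y : F) :
  \sum_(i < q) x ^+ i * dualmon i y = (x == y)%:R.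
Proof.
have q_gt0 : (0 < q)%N by rewrite -card_F; apply/card_gt0P; exists 0.
under eq_bigr do rewrite mulrBr.
rewrite sumrB (bigD1 (Ordinal q_gt0)) //= mulr1 big1 ?addr0; last first.
  by move=> i; rewrite -val_eqE /= => /negPf->; rewrite mulr0.
have [<-|neq_xy] := eqVneq x y.
  (* For x = y every term is x^(q-1), and q equal terms add up to 0. *)
  under eq_bigr => i _.
    rewrite -exprD subnKC; last by rewrite -ltnS prednK.
    over.
  by rewrite sumr_const card_ord -[X in _ - X]mulr_natl natr_card mul0r subr0.
(* Since x^q = x and y^q = y, the factorization of y^q - x^q reads y - x = (y - x) * S with S the
   remaining sum, so S = 1. *)
have := subrXX y x q; rewrite -{1 2}card_F !expf_card => xy.
apply/eqP; rewrite subr_eq0 eq_sym; apply/eqP.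
have yx0 : y - x != 0 by rewrite subr_eq0 eq_sym.
apply: (mulfI yx0); rewrite expr0 mulr1 [RHS]xy; congr (_ * _).
by apply: eq_bigr => i _; rewrite mulrC.
Qed.

End FiniteField.

Section AffineCode.
Context {F : fieldType} {q : nat} (alpha : 'I_q -> F).
Local Open Scope classical_set_scope.

Definition affeval (f : {mpoly F[4]}) : 'M[F]_q :=
  row' ord0 (col' ord0 (evalmx alpha f)).

Lemma affevalE f r c : affeval f r c = eval4 f (1, alpha c) (1, alpha r).
Proof. by rewrite !mxE /P1pt !liftK. Qed.

Fact affeval_is_linear : linear affeval.
Proof.
move=> k f g; apply/matrixP => r c.
rewrite affevalE [RHS]mxE [X in _ = X + _]mxE !affevalE.
by rewrite /eval4 mevalD mevalZ.
Qed.

HB.instance Definition _ :=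
  GRing.isLinear.Build F {mpoly F[4]} 'M[F]_q *:%R affeval affeval_is_linear.

Definition affmon (i j : nat) : 'M[F]_q :=
  \matrix_(r, c) (alpha c ^+ i * alpha r ^+ j).

Lemma affeval_monomial d1 d2 c1 c2 :
  affeval (X1 F ^+ d1 * X2 F ^+ d2 * T1 F ^+ c1 * T2 F ^+ c2) = affmon d2 c2.
Proof.
apply/matrixP => r c; rewrite affevalE mxE /eval4.
by rewrite !rmorphM !rmorphXn /= !mevalXU /= !expr1n mul1r mulr1.
Qed.

(** The inequalities say that the exponents forced by the grading, d1 = a - i and c1 = b - e i - j,
    are nonnegative. *)
Definition affmons (e : nat) (a b : int) : set 'M[F]_q :=
  [set M | exists i j : nat,
    [/\ i%:Z <= a, j%:Z + e%:Z * i%:Z <= b & M = affmon i j]].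

Lemma affmons_down {e a b i j i' j'} :
  i%:Z <= a -> j%:Z + e%:Z * i%:Z <= b -> (i' <= i)%N -> (j' <= j)%N ->
  affmons e a b (affmon i' j').
Proof. by move=> ia jb i'i j'j; exists i', j'; split=> //; nia. Qed.

Lemma affcodeE e a b : affcode alpha e a b = lspan (affmons e a b).
Proof.
have <- : [set affeval f | f in @Lmonomials F e a b] = affmons e a b.
  apply/seteqP; split.
    move=> _ [_ [d1 [d2 [c1 [c2 [da cb ->]]]]] <-]; exists d2, c2.
    by rewrite affeval_monomial; split=> //; nia.
  move=> _ [i [j [ia jb ->]]].
  pose d1 : nat := absz (a - i%:Z)%R.
  pose c1 : nat := absz (b - e%:Z * i%:Z - j%:Z)%R.
  exists (X1 F ^+ d1 * X2 F ^+ i * T1 F ^+ c1 * T2 F ^+ j).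
    by exists d1, i, c1, j; split=> //; nia.
  exact: affeval_monomial.
rewrite -lspan_image; apply/seteqP; split.
  by move=> _ [_ [f Lf <-] <-]; exists f.
by move=> _ [f Lf <-]; exists (evalmx alpha f) => //; exists f.
Qed.

End AffineCode.

Section Duality.
Context {F : finFieldType} {q : nat} {alpha : 'I_q -> F}.
Context (alpha_bij : bijective alpha).
Local Notation dualmon := (@dualmon F q).
Local Notation affmon := (affmon alpha).
Local Notation affmons := (affmons alpha).

Lemma card_domain : #|F| = q.
Proof. by rewrite -(bij_eq_card alpha_bij) card_ord. Qed.

Lemma mxdot_affmon i j i' j' :
  mxdot (affmon i j) (affmon i' j') =
  (\sum_(x : F) x ^+ (i + i')) * \sum_(y : F) y ^+ (j + j').
Proof.
rewrite (reindex alpha) ?(reindex alpha (F := fun y => y ^+ (j + j'))) /=;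
  [|exact: onW_bij..].
rewrite mulrC mulr_suml; apply: eq_bigr => r _; rewrite mulr_sumr.
by apply: eq_bigr => c _; rewrite !mxE !exprD mulrACA mulrC.
Qed.

Definition dualaffmon (i j : nat) : 'M[F]_q :=
  \matrix_(r, c) (dualmon i (alpha c) * dualmon j (alpha r)).

(** [V] is the Vandermonde matrix of [alpha] and, by [sum_dualmon], [W] is its inverse. The entries
    of W A W^T are the inner products of A with the words [dualaffmon i j]. *)
Lemma affmon_expansion (A : 'M[F]_q) :
  A = \sum_(p : 'I_q * 'I_q) mxdot A (dualaffmon p.1 p.2) *: affmon p.1 p.2.
Proof.
pose V : 'M[F]_q := \matrix_(r, i) alpha r ^+ i.
pose W : 'M[F]_q := \matrix_(i, r) dualmon i (alpha r).
have VW : V *m W = 1%:M.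
  apply/matrixP => r c; rewrite !mxE -(inj_eq (bij_inj alpha_bij)).
  rewrite -(sum_dualmon card_domain).
  by apply: eq_bigr => i _; rewrite !mxE.
have {1}-> : A = V *m (W *m A *m W^T) *m V^T.
  by rewrite !mulmxA VW mul1mx -mulmxA -trmx_mul VW trmx1 mulmx1.
apply/matrixP => r c; rewrite !mxE summxE -(pair_bigA _ (fun i j : 'I_q =>
  (mxdot A (dualaffmon i j) *: affmon i j) r c)) /=.
apply: eq_bigr => i _; rewrite !mxE mulr_suml; apply: eq_bigr => j _.
rewrite !mxE [alpha r ^+ j * _]mulrC -mulrA [_ ^+ j * _]mulrC; congr (_ * _).
rewrite /mxdot exchange_big /=; apply: eq_bigr => c' _.
rewrite !mxE mulr_suml; apply: eq_bigr => r' _.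
by rewrite !mxE mulrAC mulrC; congr (_ * _); rewrite mulrC.
Qed.

Lemma dualaffmon_lspan e a b i j :
  (q.-1 - i)%:Z <= a -> (q.-1 - j)%:Z + e%:Z * (q.-1 - i)%:Z <= b ->
  lspan (affmons e a b) (dualaffmon i j).
Proof.
move=> ia jb.
have mon i' j' : (i' <= q.-1 - i)%N -> (j' <= q.-1 - j)%N ->
    lspan (affmons e a b) (affmon i' j').
  by move=> i'i j'j; apply/sub_lspan/(affmons_down alpha ia jb).
have -> : dualaffmon i j =
    ((i == 0%N)%:R * (j == 0%N)%:R) *: affmon 0 0
    + (- (i == 0%N)%:R) *: affmon 0 (q.-1 - j)
    + (- (j == 0%N)%:R) *: affmon (q.-1 - i) 0
    + affmon (q.-1 - i) (q.-1 - j).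
  by apply/matrixP => r c; rewrite !mxE /dualmon !expr0; ring.
by repeat apply: lspanD; try apply: lspanZ; apply: mon.
Qed.

End Duality.

Theorem theorem3p13 (F : finFieldType) (q : nat) (alpha : 'I_q -> F)
    (alpha_bij : bijective alpha) (e a b : nat)
    (hab : 0 <= b%:Z - e%:Z * a%:Z) :
  let C1 := affcode_sigma alpha e (q%:Z - 1) (q%:Z - 2 - b%:Z) in
  let C2 := affcode_sigma alpha e (q%:Z - 2 - a%:Z) (q%:Z - 1) in
  dual (affcode alpha e a%:Z b%:Z) = sumset C1 C2.
Proof.
have card_F := card_domain alpha_bij.
have q_gt1 : (1 < q)%N by rewrite -card_F finNzRing_gt1.
move=> C1 C2; rewrite {}/C1 {}/C2 /affcode_sigma !affcodeE.
apply/seteqP; split=> [A dA|_ [A C1A [B C2B <-]]].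
  (* [P] is the x-degree bound i <= q-2-a of C2; as j <= q-1, it already places the monomial in
     C2. *)
  pose P (p : 'I_q * 'I_q) := (p.1 + a + 2 <= q)%N.
  rewrite [A](affmon_expansion alpha_bij) (bigID P) /= addrC.
  set u := \sum_(p | ~~ P p) _; set v := \sum_(p | P p) _.
  exists u; last exists v => //; rewrite {}/u {}/v.
    apply: lspan_sum => -[i j] /= nP; have [lt_iq lt_jq] := (ltn_ord i, ltn_ord j).
    have [le_j|lt_j] := boolP
      (j%:Z + e%:Z * i%:Z <= q%:Z - 2 - b%:Z + e%:Z * (q%:Z - 1)).
      by apply/lspanZ/sub_lspan; exists i, j; split=> //; lia.
    (* Failing both bounds means q-1-i <= a and (q-1-j) + e(q-1-i) <= b, so the complementary
       exponents lie in the region of the code. *)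
    rewrite dA ?scale0r; first exact: lspan0.
    by apply: dualaffmon_lspan; rewrite /P /= in nP; nia.
  apply: lspan_sum => -[i j]; rewrite /P /= => le_i.
  apply/lspanZ/sub_lspan; exists i, j; split=> //; first by lia.
  by have := ltn_ord j; nia.
have mxdot0 i j i' j' : (i + i' < q.-1)%N || (j + j' < q.-1)%N ->
    mxdot (affmon alpha i j) (affmon alpha i' j') = 0.
  rewrite mxdot_affmon // => /orP[] lt_q.
    by rewrite (sum_expr_eq0 card_F _ lt_q) mul0r.
  by rewrite (sum_expr_eq0 card_F _ lt_q) mulr0.
rewrite dual_lspan => M SM; rewrite mxdotC linearD /= ![mxdot M _]mxdotC.
(* Against C2, i + i' <= q-2 at once. Against C1, adding the weighted bounds gives (j + j') + e(i +
   i') <= q-2 + e(q-1), so i + i' >= q-1 forces j + j' <= q-2. *)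
rewrite (lspan_sub_dual _ A C1A M SM) ?(lspan_sub_dual _ B C2B M SM) ?addr0 //.
  move=> _ _ [i [j [ia jb ->]]] [i' [j' [i'a j'b ->]]].
  by apply: mxdot0; nia.
move=> _ _ [i [j [ia jb ->]]] [i' [j' [i'a j'b ->]]].
by apply: mxdot0; nia.
Qed.
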